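(* Let $n\ge2$ and $1\le r\le n$. Then $X_r$ is a connected graph in $\mathcal{H}(n,2)$ with balanced fractional revival at time $\pi/4$ if and only if the following hold: (i) $n$ is odd, and $n-1$ is not a power of $2$; (ii) the binary representation $(r-1)_2$ is obtained from $(n-1)_2$ by replacing some (at least one) of the $1$'s with $0$'s, except at the $\alpha_2(n-1)$-th position (where the digit $1$ is kept).
   Context: The graph $X_r$ in the binary Hamming scheme $\mathcal{H}(n,2)$ has as vertices the binary sequences of length $n$, two being adjacent iff their Hamming distance is exactly $r$. Let $U(t)=e^{-\mathrm{i}tA}$ where $A$ is the adjacency matrix of $X_r$. Balanced fractional revival at time $\tau$ means that there are vertices $a\ne b$ and complex $\alpha,\beta$ with $|\alpha|=|\beta|=1/\sqrt2$ and $U(\tau)\mathbf{e}_a=\alpha\mathbf{e}_a+\beta\mathbf{e}_b$. (In $\mathcal{H}(n,2)$ with $n\ge 2$ this is equivalent to $U(\tau)=\alpha I+\beta A_n$ with $A_n$ the adjacency matrix of $X_n$.) For a positive integer $m$, $\alpha_2(m)$ is the largest $k$ such that $2^k$ divides $m$, and $(m)_2$ is the binary representation of $m$; digit positions are counted from $0$ at the least significant digit. *)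

(* Defs.v *)
From HB Require Import structures.
From mathcomp Require Import all_boot all_order all_algebra complex.
From mathcomp Require Import all_classical all_reals all_analysis.

Set Implicit Arguments.
Unset Strict Implicit.
Unset Printing Implicit Defensive.

Import Order.TTheory GRing.Theory Num.Theory.
Import numFieldNormedType.Exports.

Local Open Scope ring_scope.
Local Open Scope classical_set_scope.
Local Open Scope complex_scope.

Definition expmx (C : numFieldType) (m : nat) (M : 'M[C]_m) : 'M[C]_m :=
  limn [series (k`!%:R)^-1 *: M ^+ k]_k.

(* Rows and columns are indexed by the vertices through [enum_rank]. *)
Definition adjmx (R : realType) (V : finType) (e : rel V) : 'M[R[i]]_#|V| :=
  \matrix_(i, j) (e (enum_val i) (enum_val j))%:R.

Definition evolution (R : realType) (V : finType) (e : rel V) (t : R) :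
    'M[R[i]]_#|V| :=
  expmx (- ('i%C * t%:C) *: adjmx R e).

Definition basis_vec (R : realType) (V : finType) (a : V) : 'cV[R[i]]_#|V| :=
  delta_mx (enum_rank a) 0.

Definition balanced_fractional_revival (R : realType) (V : finType)
    (e : rel V) (tau : R) : Prop :=
  exists (a b : V) (al be : R[i]),
    [/\ a != b,
        `|al| = ((Num.sqrt 2)^-1)%:C,
        `|be| = ((Num.sqrt 2)^-1)%:C &
        evolution e tau *m basis_vec R a
        = al *: basis_vec R a + be *: basis_vec R b].

Definition connected_graph (V : finType) (e : rel V) : Prop :=
  forall x y : V, connect e x y.

Definition hamming_dist (n : nat) (x y : n.-tuple bool) : nat :=
  #|[pred i : 'I_n | tnth x i != tnth y i]|.

Definition hamming_graph (n r : nat) : rel (n.-tuple bool) :=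
  fun x y => hamming_dist x y == r.

Definition bindigit (m i : nat) : bool := odd (m %/ 2 ^ i).

(* The binary digits of [l] are those of [m] with the 1's at the positions in
   the nonempty finite set [S] replaced by 0's, where [S] avoids position [p]. *)
Definition erases_ones_except (p m l : nat) : Prop :=
  exists S : seq nat,
    [/\ S != [::],
        forall i, i \in S -> bindigit m i /\ i != p &
        forall i, bindigit l i = if i \in S then false else bindigit m i].

(* Main.v *)
(** The characters chi_y of (Z/2)^n diagonalise X_r, with eigenvalue K(s), the
    coefficient of X^r in (1-X)^s (1+X)^(n-s), on the characters of weight s.
    Hence U(t) e_a = al e_a + be e_b iff exp(-i t K(wt y)) = al + be chi_y(a+b)
    for all y.  The left side depends on the weight of y only, which forces a+b
    to be the all-ones word; so at t = pi/4 the values exp(-i t K(s)) depend on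
    the parity of s only.  Since K(0) - K(1) = 2 C(n-1,r-1) and
    K(s) - K(s+2) = 4 C(n-2,r-1) mod 8, revival amounts to C(n-1,r-1) being odd
    and C(n-2,r-1) even; connectedness amounts to r being odd and less than n.
    Lucas' theorem mod 2 turns this into the condition on binary digits: if
    C(m,l) is odd, then C(m-1,l) is even iff l has the lowest 1 of m. *)
Require Import Defs.
From HB Require Import structures.
From mathcomp Require Import all_boot all_order all_algebra complex.
From mathcomp Require Import all_classical all_reals all_analysis.
From mathcomp Require Import ring lra zify.

Set Implicit Arguments.
Unset Strict Implicit.
Unset Printing Implicit Defensive.

Import Order.TTheory GRing.Theory Num.Theory.
Import numFieldNormedType.Exports.

Local Open Scope ring_scope.
Local Open Scope classical_set_scope.
Local Open Scope complex_scope.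

(** * The exponential series, for scalars and for diagonalised matrices *)

Definition cexpNi (R : realType) (x : R) : R[i] := cos x +i* (- sin x).

Section ExpSeries.
Variable R : realType.
Local Notation C := (Num.NumField.sort (R[i] : numFieldType)).

Lemma cvg_real_complex (u : nat -> R) (l : R) :
  u @ \oo --> l -> (fun k => (u k)%:C : C) @ \oo --> (l%:C : C).
Proof.
move=> /cvgrPdist_lt ul; apply/cvgrPdist_lt => e e0.
(* In the order on [R[i]] a positive element is real, so the radius comes from [R]. *)
have [r er] : exists r, e = r%:C by apply/complex_realP; rewrite gtr0_real.
move: e0; rewrite er ltcR => /ul; apply: filterS => k.
by rewrite -rmorphB normc_def /= expr0n /= addr0 sqrtr_sqr ltcR.
Qed.

Lemma expNi_coeffE (x : R) (k : nat) :
  (k`!%:R)^-1 * (- ('i%C * x%:C)) ^+ k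
  = (cos_coeff x k)%:C - 'i%C * (sin_coeff x k)%:C.
Proof.
have fE : (k`!%:R : R[i])^-1 = ((k`!%:R)^-1 : R)%:C.
  by rewrite fmorphV rmorph_nat.
have iE m : ('i%C : R[i]) ^+ m.*2 = ((-1) ^+ m)%:C.
  by rewrite -muln2 mulnC exprM sqr_i rmorphXn /= rmorphN1.
rewrite exprNn exprMn -rmorphXn fE /cos_coeff /sin_coeff /=.
rewrite -[in X in (-1) ^+ X](odd_double_half k) exprD.
rewrite -[((-1) ^+ _.*2)]signr_odd odd_double expr0 mulr1.
rewrite -[in X in 'i%C ^+ X](odd_double_half k) exprD iE.
case: (boolP (odd k)) => ok /=; rewrite ?mul0r ?mul1r ?rmorph0 ?add0r ?mulr0 ?subr0.
  (* [sin_coeff] takes its sign from [k.-1./2]; for odd [k] this agrees with the exponent produced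
     by the powers of i. *)
  rewrite (_ : k.-1./2 = k./2); last first.
    by rewrite -{1}(odd_double_half k) ok /= doubleK.
  by rewrite !rmorphM /= expr1; ring.
by rewrite !rmorphM /=; ring.
Qed.

Lemma cvg_expNi (x : R) :
  [series (k`!%:R)^-1 * (- ('i%C * x%:C)) ^+ k : C]_k @ \oo --> (cexpNi x : C).
Proof.
have -> : cexpNi x = (cos x)%:C - 'i%C * (sin x)%:C.
  by rewrite /cexpNi; simpc.
rewrite (_ : [series _]_k = fun k => (series (cos_coeff x) k)%:C
  - 'i%C * (series (sin_coeff x) k)%:C); last first.
  apply/funext => k; rewrite /series /= !rmorph_sum mulr_sumr -sumrB.
  by apply: eq_bigr => j _; rewrite expNi_coeffE.
have cv : (fun k => (series (cos_coeff x) k)%:C : C) @ \oo --> ((cos x)%:C : C).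
  by apply: cvg_real_complex; rewrite unlock; exact: is_cvg_series_cos_coeff.
have sv : (fun k => (series (sin_coeff x) k)%:C : C) @ \oo --> ((sin x)%:C : C).
  by apply: cvg_real_complex; rewrite unlock; exact: is_cvg_series_sin_coeff.
exact: (cvgB cv (cvgMl_tmp sv)).
Qed.

End ExpSeries.

Lemma cvg_fin_sum (K : numFieldType) (V : normedModType K) (I : finType)
    (f : I -> nat -> V) (a : I -> V) :
  (forall i, f i @ \oo --> a i) ->
  (fun N => \sum_i f i N) @ \oo --> \sum_i a i.
Proof.
move=> fa; apply: (@cvg_big V I +%R 0 xpredT _ nat \oo (index_enum I) f a) => //.
exact: add_continuous.
Qed.

(** The partial sums split into finitely many scalar exponential series, one for each [G y], and
    each converges separately. The case [k = 0] of the hypothesis makes the [G y] sum to the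
    identity. *)
Lemma expmx_spectral (R : realType) (m : nat) (Y : finType)
    (M : 'M[R[i]]_m) (x : Y -> R) (G : Y -> 'M[R[i]]_m) :
  (forall k, M ^+ k = \sum_y (- ('i%C * (x y)%:C)) ^+ k *: G y) ->
  expmx M = \sum_y cexpNi (x y) *: G y.
Proof.
move=> Mk; rewrite /expmx; set C := Num.NumField.sort _.
 apply: (cvg_lim (@norm_hausdorff _ _)).
rewrite (_ : [series _]_k = fun N => \sum_y
  ([series (k`!%:R)^-1 * (- ('i%C * (x y)%:C)) ^+ k]_k N) *: G y); last first.
  apply/funext => N; rewrite /series /=.
  under [RHS]eq_bigr do rewrite scaler_suml.
  rewrite exchange_big; apply: eq_bigr => k _.
  by rewrite Mk scaler_sumr; apply: eq_bigr => y _; rewrite scalerA.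
have cvG y : (fun N =>
    ([series (k`!%:R)^-1 * (- ('i%C * (x y)%:C)) ^+ k]_k N : C)
    *: (G y : 'M[C]_m)) @ \oo -->
    (cexpNi (x y) : C) *: (G y : 'M[C]_m).
  by apply: cvgZr_tmp; exact: cvg_expNi.
exact: (cvg_fin_sum cvG).
Qed.

(** * Parity of binomial coefficients and binary digits *)

Section BinomialParity.
Local Open Scope nat_scope.

(** One digit of Lucas' theorem: mod 2, (1+X)^(b+2k) is (1+X)^b (1+X^2)^k. The induction on [k]
    applies Pascal's rule twice. *)
Lemma odd_bin_double (b : bool) (k l : nat) :
  odd 'C(b + k.*2, l) = odd 'C(k, l./2) && (odd l ==> b).
Proof.
elim: k l => [|k IH] [|[|l]] //=.
- by rewrite !bin0.
- by rewrite addn0 bin1; case: b.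
- by rewrite addn0; case: b; rewrite ?bin0n ?binS ?bin0n //=.
- by rewrite !bin0.
- by rewrite bin1 doubleS !addnS /= oddD odd_double addbF oddb negbK.
rewrite doubleS !addnS !binS !oddD !IH /=. rewrite !negbK.
by do 4![case: odd => /=]; case: (b) => /=.
Qed.

Lemma bindigit0 m : bindigit m 0 = odd m.
Proof. by rewrite /bindigit expn0 divn1. Qed.

Lemma bindigitS m i : bindigit m i.+1 = bindigit m./2 i.
Proof. by rewrite /bindigit expnS divnMA divn2. Qed.

Lemma odd_binP (m l : nat) :
  reflect (forall i, bindigit l i -> bindigit m i) (odd 'C(m, l)).
Proof.
apply: (iffP idP); elim/ltn_ind: l m => l IH m.
  case: l IH => [_ _ i|l IH].
    by rewrite /bindigit div0n.
  rewrite -{1}(odd_double_half m) odd_bin_double => /andP[h /implyP hl] [|i].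
    by rewrite !bindigit0.
  by rewrite !bindigitS; apply: IH => //; rewrite ltn_half_double; lia.
case: l IH => [_ _|l IH h]; first by rewrite bin0.
rewrite -(odd_double_half m) odd_bin_double; apply/andP; split.
  apply: IH => [|i]; first by rewrite ltn_half_double; lia.
  by rewrite -!bindigitS; exact: h.
by apply/implyP; rewrite -!bindigit0; exact: h.
Qed.

Lemma logn2_odd m : odd m -> logn 2 m = 0.
Proof.
move=> om; apply/eqP.
by rewrite -leqn0 leqNgt logn_gt0 mem_primes dvdn2 om /= !andbF.
Qed.

Lemma logn2_double k : 0 < k -> logn 2 k.*2 = (logn 2 k).+1.
Proof. by move=> k0; rewrite -mul2n lognM // lognE. Qed.

Lemma bindigit_logn2 m : 0 < m -> bindigit m (logn 2 m).
Proof.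
elim/ltn_ind: m => m IH m0; case: (boolP (odd m)) => om.
  by rewrite logn2_odd // bindigit0.
have mE : m = (m./2).*2 by rewrite even_halfK.
have h0 : 0 < m./2 by rewrite half_gt0; lia.
rewrite mE logn2_double // bindigitS doubleK; apply: IH => //; lia.
Qed.

(** Passing from m to m-1 turns the lowest 1 of m into 0 and the 0's below it into 1's. The 1's
    below impose nothing on [l], so only the digit of [l] at the lowest 1 of m matters. *)
Lemma odd_bin_pred (m l : nat) : 0 < m -> odd 'C(m, l) ->
  odd 'C(m.-1, l) = ~~ bindigit l (logn 2 m).
Proof.
elim/ltn_ind: m l => m IH l m0; case: (boolP (odd m)) => om.
  rewrite logn2_odd // bindigit0.
  rewrite -(odd_double_half m) om odd_bin_double => /andP[h _].
  by rewrite -[(true + _).-1]/(false + _) odd_bin_double h implybF.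
have h0 : 0 < m./2 by rewrite half_gt0; lia.
have mE : m = (m./2).*2 by rewrite even_halfK.
rewrite [in 'C(m, _)]mE -[_.*2]/(false + _) odd_bin_double => /andP[h _].
have -> : m.-1 = true + (m./2.-1).*2 by lia.
rewrite odd_bin_double implybT andbT IH //; last lia.
by rewrite [in RHS]mE logn2_double // bindigitS.
Qed.

Lemma bindigit_gt m i : m <= i -> bindigit m i = false.
Proof.
move=> mi; rewrite /bindigit divn_small //.
by apply: leq_ltn_trans mi _; exact: ltn_expl.
Qed.

(** Equal digits make both 'C(m, l) and 'C(l, m) odd, hence nonzero, which gives both
    inequalities. *)
Lemma bindigit_inj m l : bindigit m =1 bindigit l -> m = l.
Proof.
have le a b : bindigit a =1 bindigit b -> a <= b.
  move=> ab; have : odd 'C(b, a) by apply/odd_binP => i; rewrite ab.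
  by apply: contraTT; rewrite -ltnNge => /bin_small ->.
by move=> ml; apply/eqP; rewrite eqn_leq !le // => i; rewrite ml.
Qed.

Lemma bindigit_expn2 k i : bindigit (2 ^ k) i = (i == k).
Proof.
elim: k i => [|k IH] [|i]; rewrite ?bindigit0 ?bindigitS //.
- by rewrite /bindigit div0n.
- by rewrite oddX.
- by rewrite expnS mul2n doubleK IH.
Qed.

(** Digits of [l] lying under those of [m] means 'C(m, l) odd; a nonempty [S] means l < m; keeping
    the lowest 1 of [m] means 'C(m-1, l) even. *)
Lemma erases_ones_exceptP (m l : nat) : 0 < m -> l <= m ->
  [/\ ~~ odd m, ~ (exists k, m = 2 ^ k) & erases_ones_except (logn 2 m) m l]
  <-> [/\ ~~ odd l, l < m, odd 'C(m, l) & ~~ odd 'C(m.-1, l)].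
Proof.
move=> m0 lm; split.
  move=> [om _ [S [S0 SP lE]]].
  have sub : forall i, bindigit l i -> bindigit m i.
    by move=> i; rewrite lE; case: ifP.
  have oC : odd 'C(m, l) by apply/odd_binP.
  split=> //.
  - by apply: contra om; rewrite -!bindigit0; exact: sub.
  - rewrite ltn_neqAle lm andbT; apply/eqP => lmE.
    case: S S0 SP lE => // i S _ SP lE.
    have [mi _] := SP i (mem_head _ _).
    by move: (lE i); rewrite lmE mem_head mi.
  - rewrite odd_bin_pred // negbK lE; case: ifP => [/SP[_]|_].
      by rewrite eqxx.
    exact: bindigit_logn2.
move=> [ol lm' oC oC']; have /odd_binP sub := oC.
have lp : bindigit l (logn 2 m) by move: oC'; rewrite odd_bin_pred // negbK.
(* For odd [m] the protected position would be 0, where the even [l] has digit 0. *)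
have om : ~~ odd m.
  by apply/negP => om; move: lp; rewrite logn2_odd // bindigit0 (negPf ol).
(* The erased positions; all 1's of [m] lie at positions below [m], so the search is finite. *)
pose S := [seq i <- iota 0 m | bindigit m i && ~~ bindigit l i].
have memS i : (i \in S) = bindigit m i && ~~ bindigit l i.
  rewrite mem_filter mem_iota /= add0n; case: (ltnP i m) => im; rewrite ?andbT //.
  by rewrite bindigit_gt.
have [i Si] : exists i, i \in S.
  case E : S => [|i S']; last by exists i; rewrite mem_head.
  move: lm'; suff -> : m = l by rewrite ltnn.
  apply: bindigit_inj => i; apply/idP/idP => [mi|/sub //].
  by have := memS i; rewrite E in_nil mi /=; case: bindigit.
have iS j : j \in S -> bindigit m j /\ j != logn 2 m.
  rewrite memS => /andP[mj lj]; split=> //; apply: contraNneq lj => ->.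
  exact: lp.
split=> //.
  (* The only 1 of a power of 2 is at the protected position, which leaves nothing to erase. *)
  move=> [k mE]; have [] := iS _ Si.
  by rewrite mE pfactorK // bindigit_expn2 => ->.
exists S; split=> //; first by apply: contraTneq Si => ->.
move=> j; rewrite memS.
by have := sub j; case: (bindigit m j); case: (bindigit l j) => //= ->.
Qed.

End BinomialParity.

(** * Connectedness of X_r *)

Section HammingConnectivity.
Local Open Scope nat_scope.
Variable n : nat.
Implicit Types x y z : n.-tuple bool.

Definition xort x y : n.-tuple bool := [tuple tnth x i (+) tnth y i | i < n].

Definition indt (A : pred 'I_n) : n.-tuple bool := [tuple A i | i < n].

Definition wt x := #|[pred i | tnth x i]|.

Lemma tnth_xort x y i : tnth (xort x y) i = tnth x i (+) tnth y i.
Proof. exact: tnth_mktuple. Qed.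

Lemma tnth_indt A i : tnth (indt A) i = A i.
Proof. exact: tnth_mktuple. Qed.

Lemma xortA : associative xort.
Proof. by move=> x y z; apply: eq_from_tnth => i; rewrite !tnth_xort addbA. Qed.

Lemma xortKl x y : xort x (xort x y) = y.
Proof. by apply: eq_from_tnth => i; rewrite !tnth_xort addKb. Qed.

Lemma hamming_distE x y : hamming_dist x y = wt (xort x y).
Proof.
apply: eq_card => i; rewrite !inE tnth_xort.
by case: (tnth x i); case: (tnth y i).
Qed.

Lemma wt_indt A : wt (indt A) = #|A|.
Proof. by apply: eq_card => i; rewrite !inE tnth_indt. Qed.

Lemma odd_wt x : odd (wt x) = \big[addb/false]_i tnth x i.
Proof.
rewrite /wt -sum1_card (big_morph odd oddD (erefl _)) big_mkcond /=.
by apply: eq_bigr => i _; rewrite inE; case: (tnth x i).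
Qed.

Lemma odd_wt_xort x y : odd (wt (xort x y)) = odd (wt x) (+) odd (wt y).
Proof.
by rewrite !odd_wt -big_split; apply: eq_bigr => i _; rewrite tnth_xort.
Qed.

Variable r : nat.

(** X_r is invariant under translation, so it suffices to follow displacements; quantifying over the
    start [x] makes them closed under addition. *)
Definition reachable z := forall x, connect (@hamming_graph n r) x (xort x z).

Lemma reachableD z z' : reachable z -> reachable z' -> reachable (xort z z').
Proof.
by move=> hz hz' x; apply: connect_trans (hz x) _; rewrite xortA; exact: hz'.
Qed.

Lemma reachable_wt z : wt z = r -> reachable z.
Proof.
by move=> zr x; apply: connect1; rewrite /hamming_graph hamming_distE xortKl zr.
Qed.

(** As r < n, some set s of r-1 positions avoids both [i] and [j]. The words of s with [i] added and
    of s with [j] added have weight r, and their sum is the pair. *)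
Lemma reachable_pair (i j : 'I_n) : 0 < r < n -> i != j ->
  reachable (indt (pred2 i j)).
Proof.
move=> /andP[r0 rn] ij.
have : r.-1 <= #|[predC (pred2 i j)]|.
  have := cardC (pred2 i j); rewrite card_ord card2 ij /= => h.
  by rewrite -(leq_add2l 2) h; lia.
move=> /card_geqP[s [us sr sub]].
have wts k : k \notin s -> wt (indt (predU1 k (mem s))) = r.
  by move=> ks; rewrite wt_indt cardU1 ks (card_uniqP us) sr; lia.
have is' : i \notin s by apply/negP => /sub; rewrite !inE eqxx.
have js : j \notin s by apply/negP => /sub; rewrite !inE eqxx orbT.
have -> : indt (pred2 i j) = xort (indt (predU1 i (mem s))) (indt (predU1 j (mem s))).
  apply: eq_from_tnth => k; rewrite tnth_xort !tnth_indt /=.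
  case: (eqVneq k i) => [->|ki]; first by rewrite (negPf ij) (negPf is').
  by case: (eqVneq k j) => [->|kj]; rewrite ?(negPf js) //= addbb.
by apply: reachableD; apply: reachable_wt; exact: wts.
Qed.

(** Adding the pair of two 1's of [z] lowers the weight by two, so even words are sums of pairs. *)
Lemma reachable_even z : 0 < r < n -> ~~ odd (wt z) -> reachable z.
Proof.
move=> rn; have [m] := ubnP (wt z); elim: m z => // m IH z zm oz.
have [z0|] := posnP (wt z).
  move=> x; suff -> : xort x z = x by [].
  apply: eq_from_tnth => i; rewrite tnth_xort.
  by move/card0_eq/(_ i): z0; rewrite inE => ->; rewrite addbF.
move=> z0; have : 1 < wt z by case: (wt z) z0 oz => [|[|]].
move=> /card_gt1P[i [j [zi zj ij]]].
rewrite -(xortKl (indt (pred2 i j)) z); apply: reachableD.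
  exact: reachable_pair.
have oz' : ~~ odd (wt (xort (indt (pred2 i j)) z)).
  by rewrite odd_wt_xort wt_indt card2 ij.
apply: IH oz'; rewrite -ltnS; apply: leq_trans zm; rewrite ltnS.
apply: proper_card; apply/properP; split.
  apply/fintype.subsetP => k; rewrite !inE tnth_xort tnth_indt /=.
  case: (eqVneq k i) => [->|ki] //; case: (eqVneq k j) => [->|kj] //.
by exists i; rewrite // !inE tnth_xort tnth_indt /= eqxx; move: zi; rewrite inE => ->.
Qed.

Lemma connected_hammingP : 2 <= n -> 0 < r <= n ->
  connected_graph (@hamming_graph n r) <-> odd r /\ r < n.
Proof.
move=> n2 /andP[r0 rn]; split=> [conn|[or rn'] x y]; last first.
  suff h z : reachable z by rewrite -(xortKl x y); exact: h.
  have rr : 0 < r < n by rewrite r0.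
  have [oz|] := boolP (odd (wt z)); last exact: reachable_even.
  have [s [us sr _]] : exists s, [/\ uniq s, size s = r & {subset s <= 'I_n}].
    by apply/card_geqP; rewrite card_ord.
  have wts : wt (indt (mem s)) = r by rewrite wt_indt (card_uniqP us).
  (* As r is odd, splitting off one word of weight r reduces an odd [z] to an even one. *)
  rewrite -(xortKl (indt (mem s)) z); apply: reachableD.
    exact: reachable_wt.
  by apply: reachable_even; rewrite // odd_wt_xort wts or oz.
pose i0 : 'I_n := Ordinal (ltnW n2); pose i1 : 'I_n := Ordinal n2.
have i01 : i0 != i1 by [].
(* These two words are separated by both invariants below: the parity of the weight, kept by edges
   when r is even, and the sum of digits 0 and 1, kept when r = n because an edge then flips every
   digit. *)
have H := conn (indt pred0) (indt (pred1 i0)).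
split.
  apply: contraT => er.
  have cl : fingraph.closed (@hamming_graph n r) [pred x | odd (wt x)].
    move=> x y; rewrite /hamming_graph hamming_distE => /eqP xy.
    by move: er; rewrite -xy odd_wt_xort !inE; case: (odd (wt x)); case: odd.
  by have := closed_connect cl H; rewrite !inE !wt_indt card0 card1.
rewrite ltn_neqAle rn andbT; apply/eqP => rE.
have cl : fingraph.closed (@hamming_graph n r) [pred x | tnth x i0 (+) tnth x i1].
  move=> x y; rewrite /hamming_graph hamming_distE rE => /eqP xy.
  have full i : tnth (xort x y) i.
    have /subset_cardP h : #|[pred i | tnth (xort x y) i]| = #|'I_n|.
      by rewrite card_ord.
    by have /h/(_ i) := subset_predT [pred i | tnth (xort x y) i]; rewrite !inE.
  have := full i0; have := full i1; rewrite !tnth_xort !inE.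
  by case: (tnth x i0) (tnth x i1) (tnth y i0) (tnth y i1) => [] [] [] [].
by have := closed_connect cl H; rewrite !inE !tnth_indt /=.
Qed.

End HammingConnectivity.

(** * Characters of (Z/2)^n and Krawtchouk values *)

Section Characters.
Variable n : nat.
Implicit Types x y z : n.-tuple bool.

Lemma sum_tuple_prod (S : comNzRingType) (F : 'I_n -> bool -> S) :
  \sum_(x : n.-tuple bool) \prod_i F i (tnth x i)
  = \prod_i (F i true + F i false).
Proof.
under [RHS]eq_bigr do rewrite -big_bool.
rewrite bigA_distr_bigA.
rewrite (reindex (fun x : n.-tuple bool => [ffun i => tnth x i])) /=.
  by apply: eq_bigr => x _; apply: eq_bigr => i _; rewrite ffunE.
exists (fun f : {ffun 'I_n -> bool} => [tuple f i | i < n]) => [x|f] _.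
  by apply: eq_from_tnth => i; rewrite tnth_mktuple ffunE.
by apply/ffunP => i; rewrite ffunE tnth_mktuple.
Qed.

(** The character (-1)^(y.x), valued in [int] so that the eigenvalues are integers to which
    congruences apply. *)
Definition chi y x : int := \prod_i (-1) ^+ (tnth y i && tnth x i).

Lemma chiC y x : chi y x = chi x y.
Proof. by apply: eq_bigr => i _; rewrite andbC. Qed.

Lemma chiD y x z : chi y (xort x z) = chi y x * chi y z.
Proof.
rewrite -big_split; apply: eq_bigr => i _; rewrite tnth_xort /=.
by rewrite -signr_addb andb_addr.
Qed.

Lemma chi_sqr y x : chi y x * chi y x = 1.
Proof. by rewrite -big_split big1 // => i _; rewrite /= -signr_addb addbb. Qed.

Lemma xort_eq0 x y : (xort x y == indt pred0) = (x == y).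
Proof.
apply/eqP/eqP => [xy|->].
  apply: eq_from_tnth => i; have /(congr1 (fun t => tnth t i)) := xy.
  by rewrite tnth_xort tnth_indt /=; case: (tnth x i); case: (tnth y i).
by apply: eq_from_tnth => i; rewrite tnth_xort tnth_indt addbb.
Qed.

(** The sum factors over positions, and a position where [x] has a 1 contributes 1 + (-1) = 0. *)
Lemma sum_chi x : \sum_y chi y x = (2 ^ n)%:R * (x == indt pred0)%:R.
Proof.
rewrite (sum_tuple_prod (fun i b => (-1) ^+ (b && tnth x i))) /=.
case: eqP => [->|xn].
  transitivity (\prod_(i < n) (2 : int)); last first.
    by rewrite prodr_const card_ord mulr1 natrX.
  by apply: eq_bigr => i _; rewrite tnth_indt.
have /existsP[i xi] : [exists i, tnth x i].
  apply: contra_notT xn => /existsPn xn; apply: eq_from_tnth => i.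
  by rewrite tnth_indt; exact: negbTE.
by rewrite mulr0 (bigD1 i) //= xi mul0r.
Qed.

(** The exponents are independent because differences of eigenvalues lead to s + u = n - 2. *)
Definition kraw_poly (s u : nat) : {poly int} := (1 - 'X) ^+ s * (1 + 'X) ^+ u.

(* The Krawtchouk polynomial $K_r$ of the scheme $\mathcal{H}(n,2)$ at s. *)
Definition kraw (r s : nat) : int := (kraw_poly s (n - s))`_r.

Lemma sum_chi_sphere (r : nat) y : \sum_(z | wt z == r) chi y z = kraw r (wt y).
Proof.
(* X marks the weight: the sum of chi_y(z) X^(wt z) over all z is the product of the 1 + (-1)^(y_i)
   X. *)
pose F i (b : bool) : {poly int} :=
  if b then ((-1) ^+ tnth y i)%:P * 'X else 1.
have -> : kraw r (wt y) = (\prod_i (F i true + F i false))`_r.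
  rewrite /kraw /kraw_poly; congr (polyseq _)`_r.
  rewrite (bigID (tnth y)) /=; congr (_ * _).
    rewrite -[LHS]prodr_const; apply: eq_big => i; first by rewrite inE.
    by rewrite inE /F => ->; rewrite expr1 polyCN mulN1r addrC.
  have -> : (n - wt y)%N = #|[pred i | ~~ tnth y i]|.
    by rewrite -[X in (X - _)%N]card_ord -(cardC [pred i | tnth y i]) addKn.
  rewrite -[LHS]prodr_const; apply: eq_big => i; first by rewrite inE.
  by rewrite inE /F => /negPf ->; rewrite expr0 mul1r addrC.
rewrite -sum_tuple_prod coef_sum big_mkcond /=; apply: eq_bigr => z _.
have -> : \prod_i F i (tnth z i) = (chi y z)%:P * 'X^(wt z).
  have -> : 'X^(wt z) = \prod_i (if tnth z i then 'X else 1 : {poly int}).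
    by rewrite -big_mkcond prodr_const.
  rewrite /chi rmorph_prod -big_split /=; apply: eq_bigr => i _; rewrite /F.
  by case: (tnth z i); rewrite ?andbT // andbF mulr1.
by rewrite coefCM coefXn eq_sym; case: eqP; rewrite ?mulr1 ?mulr0.
Qed.

End Characters.

(** * Spectral decomposition of X_r and of its evolution *)

Section Spectral.
Variable R : realType.

Lemma exp_orthogonal_idempotents (m : nat) (Y : finType) (S : comNzRingType)
    (G : Y -> 'M[S]_m) (c : Y -> S) (k : nat) :
  \sum_y G y = 1%:M -> (forall y z, G y *m G z = (y == z)%:R *: G y) ->
  (\sum_y c y *: G y) ^+ k = \sum_y c y ^+ k *: G y.
Proof.
move=> G1 GG; elim: k => [|k IH].
  by rewrite expr0 -[LHS]G1; apply: eq_bigr => y _; rewrite expr0 scale1r.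
rewrite exprS IH -[LHS]/(_ *m _) mulmx_suml; apply: eq_bigr => y _.
rewrite mulmx_sumr (bigD1 y) //= big1 ?addr0 => [|z zy].
  by rewrite -scalemxAr -scalemxAl GG eqxx scale1r scalerA exprSr.
by rewrite -scalemxAr -scalemxAl GG eq_sym (negPf zy) !scale0r !scaler0.
Qed.

Variable n : nat.
Implicit Types y : n.-tuple bool.
Local Notation V := (n.-tuple bool).

(** The orthogonal projection onto the line of chi_y: its entry is chi_y(a) chi_y(c) / 2^n. *)
Definition charmx y : 'M[R[i]]_#|{: V}| :=
  \matrix_(i, j) ((chi y (xort (enum_val i) (enum_val j)))%:~R / (2 ^ n)%:R).

Lemma charmx_basis y (a c : V) :
  (charmx y *m basis_vec R a) (enum_rank c) 0
  = (chi y (xort c a))%:~R / (2 ^ n)%:R.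
Proof. by rewrite /basis_vec -colE !mxE !enum_rankK. Qed.

Let two_n_neq0 : (2 ^ n)%:R != 0 :> R[i].
Proof. by rewrite pnatr_eq0 expn_eq0. Qed.

Lemma sum_charmx : \sum_y charmx y = 1%:M.
Proof.
apply/matrixP => i j; rewrite summxE !mxE.
under eq_bigr do rewrite mxE.
rewrite -mulr_suml -rmorph_sum sum_chi xort_eq0 (inj_eq enum_val_inj).
by rewrite rmorphM /= !rmorph_nat mulrAC divff // mul1r.
Qed.

Lemma charmxM y z : charmx y *m charmx z = (y == z)%:R *: charmx y.
Proof.
apply/matrixP => i j; rewrite !mxE.
set c : R[i] := (chi y (enum_val i) * chi z (enum_val j))%:~R / (2 ^ n)%:R.
transitivity (c / (2 ^ n)%:R *
    \sum_(k < #|{: V}|) (chi (enum_val k) (xort y z))%:~R); last first.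
  rewrite -(big_enum_val (fun x => (chi x (xort y z))%:~R)) /=.
  rewrite -rmorph_sum sum_chi xort_eq0 /c.
  case: eqP => [<-|_]; last by rewrite mulr0 rmorph0 mulr0 mul0r.
  by rewrite mulr1 rmorph_nat divfK // mul1r chiD.
rewrite mulr_sumr; apply: eq_bigr => k _.
by rewrite !mxE /c !chiD !(chiC (enum_val k)) !rmorphM /=; ring.
Qed.

(** Fourier inversion: with the eigenvalue written as a character sum over the sphere of radius r,
    orthogonality leaves only z = x + y for the entry at x, y. *)
Lemma adjmx_hamming r :
  adjmx R (@hamming_graph n r) = \sum_y (kraw n r (wt y))%:~R *: charmx y.
Proof.
apply/matrixP => i j; rewrite summxE mxE.
under eq_bigr do rewrite !mxE -sum_chi_sphere mulrA -rmorphM /= mulr_suml.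
rewrite -mulr_suml -rmorph_sum exchange_big /=.
under eq_bigr => z _.
  under eq_bigr do rewrite -chiD.
  rewrite sum_chi xort_eq0; over.
rewrite -mulr_sumr rmorphM /= rmorph_nat mulrAC divff // mul1r.
rewrite /hamming_graph hamming_distE.
set x := xort _ _.
rewrite big_mkcond (bigD1 x) //= eqxx big1 ?addr0; last first.
  by move=> z /negPf ->; case: ifP.
by case: eqP.
Qed.

Lemma evolution_hamming r (t : R) :
  evolution (@hamming_graph n r) t
  = \sum_y cexpNi (t * (kraw n r (wt y))%:~R) *: charmx y.
Proof.
apply: expmx_spectral => k.
rewrite adjmx_hamming scaler_sumr.
under eq_bigr do rewrite scalerA.
rewrite (exp_orthogonal_idempotents _ _ sum_charmx charmxM).
by apply: eq_bigr => y _; rewrite mulNr -mulrA rmorphM /= rmorph_int.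
Qed.

Lemma evolution_basisP r (t : R) (a b : V) (al be : R[i]) :
  evolution (@hamming_graph n r) t *m basis_vec R a
    = al *: basis_vec R a + be *: basis_vec R b
  <-> forall y, cexpNi (t * (kraw n r (wt y))%:~R)
                = al + be * (chi y (xort a b))%:~R.
Proof.
rewrite evolution_hamming; split=> [U y|UE].
  (* Projecting onto chi_y and reading the entry at [a] isolates one eigenvalue; the factor 1 / 2^n
     then cancels. *)
  have := congr1 (fun v => (charmx y *m v) (enum_rank a) 0) U.
  rewrite mulmxA mulmx_sumr (bigD1 y) //= big1 ?addr0 => [|z zy]; last first.
    by rewrite -scalemxAr charmxM eq_sym (negPf zy) scale0r scaler0.
  rewrite -scalemxAr charmxM eqxx scale1r -scalemxAl mulmxDr -!scalemxAr.
  rewrite mxE charmx_basis [RHS]mxE mxE charmx_basis mxE charmx_basis.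
  rewrite !chiD chi_sqr !mulrA -mulrDl rmorph1 mulr1.
  have nz : ((2 ^ n)%:R : R[i])^-1 != 0 by rewrite invr_eq0.
  by rewrite mulr1; exact: (mulIf nz).
rewrite mulmx_suml -[basis_vec R a in RHS]mul1mx -[basis_vec R b]mul1mx -sum_charmx.
rewrite !mulmx_suml !scaler_sumr -big_split; apply: eq_bigr => y _ /=.
apply/colP => i; rewrite -(enum_valK i) -scalemxAl.
rewrite [LHS]mxE [RHS]mxE [X in X + _]mxE [X in _ + X]mxE !charmx_basis.
rewrite UE !chiD !rmorphM /=.
have := congr1 (fun k : int => k%:~R : R[i]) (chi_sqr y a); rewrite rmorphM rmorph1 /=.
set ca := (chi y a)%:~R; set cb := (chi y b)%:~R; set ci := (chi y _)%:~R => aa.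
rewrite -[be in RHS]mulr1 -aa; ring.
Qed.

End Spectral.

(** * Differences of Krawtchouk values *)

Section KrawtchoukCongruences.

Lemma coef_addXn (m k : nat) : (((1 + 'X) ^+ m : {poly int})`_k = 'C(m, k)%:R).
Proof.
rewrite addrC exprD1n coef_sum.
under eq_bigr do rewrite coefMn coefXn.
have [mk|km] := ltnP m k.
  rewrite bin_small // big1 // => i _; case: eqP => [ki|]; rewrite ?mul0rn //.
  by have := ltn_ord i; lia.
rewrite (bigD1 (Ordinal (km : k < m.+1)%N)) //= eqxx big1 ?addr0 // => i.
by rewrite -val_eqE /= eq_sym => /negPf ->; rewrite mul0rn.
Qed.

(** Mod 2 the factors 1 - X and 1 + X coincide. *)
Lemma kraw_poly_mod2 (s u k : nat) :
  exists c : int, (kraw_poly s u)`_k = 'C(s + u, k)%:R + 2 * c.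
Proof.
suff [q qE] : exists q : {poly int}, kraw_poly s u = (1 + 'X) ^+ (s + u) + 2 *: q.
  by exists q`_k; rewrite qE coefD coefZ coef_addXn.
elim: s => [|s [q qE]].
  by exists 0; rewrite /kraw_poly expr0 mul1r scaler0 addr0.
exists ((1 - 'X) * q - 'X * (1 + 'X) ^+ (s + u)).
have -> : kraw_poly s.+1 u = (1 - 'X) * kraw_poly s u.
  by rewrite /kraw_poly exprS mulrA.
rewrite qE addSn exprS -!mul_polyC; have -> : (2 : int)%:P = 2 by exact: rmorph_nat.
ring.
Qed.

Variable n : nat.

Lemma kraw01 (k : nat) : (0 < n)%N ->
  kraw n k.+1 0 - kraw n k.+1 1 = 2 * 'C(n - 1, k)%:R.
Proof.
move=> n0; rewrite /kraw -coefB /kraw_poly expr0 expr1 mul1r subn0.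
have -> : (1 + 'X) ^+ n - (1 - 'X) * (1 + 'X) ^+ (n - 1)
          = (2 *: (1 + 'X) ^+ (n - 1)) * 'X :> {poly int}.
  rewrite -{1}(subnK n0) addn1 exprS -mul_polyC.
  have -> : (2 : int)%:P = 2 by exact: rmorph_nat.
  ring.
by rewrite coefMX /= coefZ coef_addXn.
Qed.

(** This is (1+X)^2 - (1-X)^2 = 4X; the factor X lowers the index from k+1 to k. *)
Lemma krawSS (k s : nat) : (s.+2 <= n)%N ->
  kraw n k.+1 s - kraw n k.+1 s.+2 = 4 * (kraw_poly s (n - s.+2))`_k.
Proof.
move=> sn; rewrite /kraw -coefB.
have -> : (n - s = (n - s.+2).+2)%N by lia.
have -> : kraw_poly s (n - s.+2).+2 - kraw_poly s.+2 (n - s.+2)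
          = (4 *: kraw_poly s (n - s.+2)) * 'X.
  rewrite /kraw_poly !exprS -mul_polyC.
  have -> : (4 : int)%:P = 4 by exact: rmorph_nat.
  ring.
by rewrite coefMX /= coefZ.
Qed.

End KrawtchoukCongruences.

(** * Eighth roots of unity *)

Section Phases.
Variable R : realType.

Lemma cexpNiD (x y : R) : cexpNi (x + y) = cexpNi x * cexpNi y.
Proof. by rewrite /cexpNi cosD sinD; simpc; congr (_ +i* _); ring. Qed.

Lemma normc_cexpNi (x : R) : `|cexpNi x| = 1.
Proof. by rewrite normc_def /= sqrrN cos2Dsin2 sqrtr1. Qed.

Definition phase (k : int) : R[i] := cexpNi (pi / 4%:R * k%:~R).

Lemma phaseD (j k : int) : phase (j + k) = phase j * phase k.
Proof. by rewrite /phase intrD mulrDr cexpNiD. Qed.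

Lemma phase_neq0 (k : int) : phase k != 0.
Proof. by rewrite -normr_gt0 normc_cexpNi. Qed.

Lemma phase0 : phase 0 = 1.
Proof. by rewrite /phase mulr0 /cexpNi cos0 sin0 oppr0. Qed.

Lemma phase_double (k : nat) : phase (2 * k%:R) = (- 'i%C) ^+ k.
Proof.
elim: k => [|k IH]; first by rewrite mulr0 phase0.
rewrite -[k.+1%:R]natr1 mulrDr phaseD IH exprSr; congr (_ * _).
rewrite /phase (_ : pi / 4%:R * _ = pi / 2); last by rewrite mulr1 /=; field.
by rewrite /cexpNi cos_pihalf sin_pihalf; simpc.
Qed.

Lemma iN_sqr : (- 'i%C) ^+ 2 = -1 :> R[i].
Proof. by rewrite sqrrN sqr_i. Qed.

Lemma iN_pow (k : nat) :
  (- 'i%C) ^+ k = (-1) ^+ k./2 * (if odd k then - 'i%C else 1) :> R[i].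
Proof.
rewrite -{1}(odd_double_half k) addnC exprD -mul2n exprM iN_sqr.
by case: odd; rewrite ?expr1 ?expr0.
Qed.

Lemma phase_period (j k c : int) : j - k = 8 * c -> phase j = phase k.
Proof.
have per (m : nat) : phase (8 * m%:R) = 1.
  rewrite (_ : 8 * _ = 2 * (m * 4)%N%:R); last by rewrite natrM; ring.
  rewrite phase_double iN_pow !oddM andbF (_ : (m * 4)./2 = m * 2)%N.
    by rewrite exprM sqrr_sign mulr1.
  by lia.
move=> /(congr1 (fun x => x + k)); rewrite subrK => ->; rewrite phaseD.
(* A negative multiple of 8 is cancelled against the opposite one, whose phase is 1. *)
case: c => m; first by rewrite -[Posz m]natz per mul1r.
have -> : 8 * Negz m = - (8 * m.+1%:R) by rewrite NegzE mulrN -[Posz _]natz.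
by rewrite -[LHS]mul1r -(per m.+1) mulrA -phaseD subrr phase0 mul1r.
Qed.

End Phases.

(** * Balanced revival at time pi/4, with r = k + 1 *)

Section BalancedRevival.
Variables (R : realType) (n k : nat).
Hypothesis n_ge2 : (2 <= n)%N.
Local Notation V := (n.-tuple bool).

Lemma wt0 : wt (indt pred0 : V) = 0%N.
Proof. by rewrite wt_indt card0. Qed.

Lemma chi0l (x : V) : chi (indt pred0) x = 1.
Proof. by rewrite /chi big1 // => i _; rewrite tnth_indt. Qed.

Lemma chi_indt1 (i : 'I_n) (x : V) : chi (indt (pred1 i)) x = (-1) ^+ tnth x i.
Proof.
rewrite /chi (bigD1 i) //= tnth_indt /= eqxx big1 ?mulr1 // => j ji.
by rewrite tnth_indt /= (negPf ji).
Qed.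

Lemma chi_indtT (y : V) : chi y (indt predT) = (-1) ^+ odd (wt y).
Proof.
rewrite /chi signr_odd /wt -[RHS]prodr_const [RHS]big_mkcond /=.
by apply: eq_bigr => i _; rewrite tnth_indt andbT inE; case: (tnth y i).
Qed.

Lemma normc_half (a e : R) : a ^+ 2 = 1 -> e ^+ 2 = 1 ->
  `|(a +i* e) / 2| = ((Num.sqrt 2)^-1)%:C.
Proof.
move=> a1 e1; rewrite normrM normfV normr_nat normc_def /= a1 e1.
have s0 : Num.sqrt 2 != 0 :> R by rewrite gt_eqF // sqrtr_gt0.
have -> : (2 : R[i]) = (Num.sqrt 2 * Num.sqrt 2)%:C.
  by rewrite -expr2 sqr_sqrtr // rmorph_nat.
rewrite -[1 + 1]/(2%:R) -fmorphV -rmorphM invfM mulrA mulfV // mul1r //.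
Qed.

Lemma phase_kraw01 :
  phase R (kraw n k.+1 0) = phase R (kraw n k.+1 1) * (- 'i%C) ^+ 'C(n - 1, k).
Proof.
rewrite -phase_double -phaseD -(@kraw01 n) ?(ltnW n_ge2) //.
by congr phase; ring.
Qed.

Lemma balanced_fractional_revivalP :
  balanced_fractional_revival (@hamming_graph n k.+1) (pi / 4%:R : R)
  <-> odd 'C(n - 1, k) /\ ~~ odd 'C(n - 2, k).
Proof.
have two0 : (2 : R[i]) != 0 by rewrite pnatr_eq0.
split=> [[a [b [al [be [ab nal nbe]]]]]|[oP oQ]].
  move=> /evolution_basisP; set d := xort a b => UE.
  have nz : (Num.sqrt 2)^-1%:C != 0 :> R[i].
    by rewrite (inj_eq (@complexI _)) invr_eq0 gt_eqF // sqrtr_gt0.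
  have al0 : al != 0 by rewrite -normr_eq0 nal.
  have be0 : be != 0 by rewrite -normr_eq0 nbe.
  have E0 : phase R (kraw n k.+1 0) = al + be.
    by have := UE (indt pred0); rewrite wt0 chi0l rmorph1 mulr1.
  have Ei i : phase R (kraw n k.+1 1) = al + be * (-1) ^+ tnth d i.
    have := UE (indt (pred1 i)).
    by rewrite wt_indt card1 chi_indt1 rmorph_sign.
  have [i di] : exists i, tnth d i.
    apply/existsP; apply: contraR ab => /existsPn dn.
    rewrite -xort_eq0; apply/eqP/eq_from_tnth => i.
    by rewrite [RHS]tnth_indt /=; apply: negbTE; exact: dn.
  have E1 : phase R (kraw n k.+1 1) = al - be.
    by rewrite (Ei i) di expr1 mulrN1.
  (* Words of weight 1 share one eigenvalue, so a digit 0 in [d] would give al + be = al - be. *)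
  have dT j : tnth d j.
    apply: contraNT be0 => dj; have := Ei j.
    rewrite E1 (negPf dj) expr0 mulr1 => /addrI /eqP.
    by rewrite eq_sym -addr_eq0 -mulr2n -mulr_natl mulf_eq0 (negPf two0).
  pose i0 : 'I_n := Ordinal (ltnW n_ge2); pose i1 : 'I_n := Ordinal n_ge2.
  have E2 : phase R (kraw n k.+1 2) = al + be.
    have := UE (xort (indt (pred1 i0)) (indt (pred1 i1))).
    have -> : wt (xort (indt (pred1 i0)) (indt (pred1 i1))) = 2%N.
      have -> : xort (indt (pred1 i0)) (indt (pred1 i1)) = indt (pred2 i0 i1).
        apply: eq_from_tnth => j; rewrite tnth_xort !tnth_indt /=.
        by case: (eqVneq j i0) => [->|].
      by rewrite wt_indt card2.
    by rewrite chiC chiD !(chiC d) !chi_indt1 !dT -expr2 sqrr_sign mulr1z mulr1.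
  split.
    (* An even power of -i is a sign, so al + be would be al - be or its opposite, forcing be = 0 or
       al = 0. *)
    apply: contraT => oP; have := phase_kraw01.
    rewrite iN_pow (negPf oP) mulr1 E0 E1 -signr_odd.
    case: (odd _) => /eqP; rewrite ?expr1 ?expr0 ?mulrN1 ?mulr1 -subr_eq0.
      rewrite (_ : _ - _ = 2 * al); last by ring.
      by rewrite mulf_eq0 (negPf two0) (negPf al0).
    rewrite (_ : _ - _ = 2 * be); last by ring.
    by rewrite mulf_eq0 (negPf two0) (negPf be0).
  (* If 'C(n-2, k) were odd, the phases at 0 and 2 would differ by the factor -1, yet both equal al
     + be. *)
  apply/negP => oQ; have K02 := krawSS k n_ge2.
  move: K02; rewrite /kraw_poly expr0 mul1r coef_addXn => /eqP.
  rewrite subr_eq => /eqP K02.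
  have : phase R (kraw n k.+1 0) = phase R (kraw n k.+1 2) by rewrite E0 E2.
  rewrite K02 (_ : 4 * _ = 2 * (2 * 'C(n - 2, k))%N%:R); last first.
    by rewrite natrM; ring.
  rewrite phaseD phase_double exprM iN_sqr -signr_odd oQ expr1 mulN1r.
  by move/eqP; rewrite eqNr (negPf (phase_neq0 _ _)).
have parity s : (s <= n)%N -> phase R (kraw n k.+1 s) = phase R (kraw n k.+1 (odd s)).
  elim/ltn_ind: s => -[|[|s]] IH sn //=.
  rewrite negbK -IH //; last exact: ltnW (ltnW sn).
  have [c cE] := kraw_poly_mod2 s (n - s.+2) k.
  (* K(s) - K(s+2) = 4 ('C(n-2, k) + 2c) with an even binomial, hence 8 times the given witness. *)
  apply/esym/(@phase_period _ _ _ (('C(n - 2, k))./2%:R + c)).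
  rewrite krawSS // cE (_ : (s + (n - s.+2) = n - 2)%N); last by lia.
  rewrite -{1}(odd_double_half 'C(n - 2, k)) (negPf oQ) add0n -muln2 natrM; ring.
have [e e1 eE] : exists2 e : R, e ^+ 2 = 1 & (- 'i%C) ^+ 'C(n - 1, k) = 0 +i* e.
  exists (- (-1) ^+ ('C(n - 1, k))./2); first by rewrite sqrrN sqrr_sign.
  by rewrite iN_pow oP -(rmorph_sign (real_complex R)) /=; simpc.
set p1 := phase R (kraw n k.+1 1).
have p0E := phase_kraw01; rewrite eE -/p1 in p0E.
(* The coefficients solve al + be = p1 i e, the phase at even weights, and al - be = p1, the phase
   at odd weights. *)
exists (indt pred0), (indt predT), (p1 * ((1 +i* e) / 2)), (p1 * (((-1) +i* e) / 2)).
split.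
- apply/eqP => /(congr1 (fun t => tnth t (Ordinal n_ge2))).
  by rewrite !tnth_indt.
- by rewrite normrM normc_cexpNi mul1r normc_half // expr1n.
- by rewrite normrM normc_cexpNi mul1r normc_half // sqrrN expr1n.
apply/evolution_basisP => y; rewrite chiD (chiC y) chi0l mul1r chi_indtT.
rewrite -[LHS]/(phase R _) parity; last first.
  by rewrite -[leqRHS]card_ord max_card.
have z1 : (1 +i* e) = 1 + 0 +i* e :> R[i] by simpc.
have z2 : ((-1) +i* e) = - 1 + 0 +i* e :> R[i] by simpc.
rewrite z1 z2; case: odd; rewrite rmorph_sign ?expr1 ?expr0; last first.
  by rewrite p0E; field.
by rewrite -/p1; field.
Qed.

End BalancedRevival.

Theorem proposition4p9 (R : realType) (n r : nat)
    (hn : (2 <= n)%N) (hr1 : (1 <= r)%N) (hrn : (r <= n)%N) :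
  connected_graph (@hamming_graph n r) /\
  balanced_fractional_revival (@hamming_graph n r) (pi / 4%:R : R)%R
  <->
  [/\ odd n,
      ~ (exists k : nat, (n - 1)%N = (2 ^ k)%N) &
      erases_ones_except (logn 2 (n - 1)) (n - 1) (r - 1)].
Proof.
(* With n = m + 1 and r = l + 1, the oddness of n and r becomes the evenness of m and l. *)
case: n r hn hr1 hrn => [|m] // [|l] // m0 _ lm.
rewrite connected_hammingP //; rewrite balanced_fractional_revivalP //.
rewrite (_ : (m.+1 - 2 = m.-1)%N); last by lia.
rewrite !subn1 /=.
rewrite erases_ones_exceptP // ltnS.
by split=> [[[? ?] [? ?]]|[? ? ? ?]].
Qed.
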